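(* Let $(\alpha_i)$ be a sequence of algebraic integers with $m(\alpha_i)/[\mathbb Q(\alpha_i):\mathbb Q]\to0$ and $[\mathbb Q(\alpha_i):\mathbb Q]\to\infty$. (1) Let $k_i=\mathbb Q(\alpha_i)$ and $\pi_{k_i}(x)=\#\{\mathfrak p\text{ prime ideal of }\mathcal O_{k_i}: N(\mathfrak p)\le x\}$. Then for every $x>0$, $\lim_{i\to\infty}\pi_{k_i}(x)/[k_i:\mathbb Q]=0$. (2) Let $N\ge1$ and for each $i$ let $k_i$ be a subfield of $\mathbb Q(\alpha_i)$ with $[\mathbb Q(\alpha_i):k_i]\le N$. Then for every $x>0$, $\lim_{i\to\infty}\pi_{k_i}(x)/[k_i:\mathbb Q]=0$.
   Context: $m(\alpha)$ denotes the logarithmic Mahler measure $\sum_\nu\log^+|\alpha|_\nu$ over the places $\nu$ of $\mathbb Q(\alpha)$, $\log^+t=\max\{\log t,0\}$. $N(\mathfrak p)=|\mathcal O_k/\mathfrak p|$. *)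

(* Defs.v *)
From HB Require Import structures.
From mathcomp Require Import all_boot all_order all_algebra all_field.
From mathcomp Require Import ring_quotient finmap complex.
From mathcomp Require Import all_classical all_reals all_analysis.
Set Implicit Arguments.
Unset Strict Implicit.
Unset Printing Implicit Defensive.
Import Order.TTheory GRing.Theory Num.Theory numFieldNormedType.Exports.
Local Open Scope classical_set_scope.
Local Open Scope ring_scope.

(* A number field is a [fieldExtType rat].  A subfield [k : {subfield L}] is
   itself one through [subvs_of k]; its degree over Q is [\dim k]. *)

Definition algebraic_integer (F : fieldExtType rat) (x : F) : Prop :=
  integralOver (intr : int -> F) x.

Definition integers_pred (F : fieldExtType rat) : {pred F} :=
  fun x => `[< algebraic_integer x >].
Arguments integers_pred : clear implicits.

Fact integers_subring_closed (F : fieldExtType rat) :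
  subring_closed (integers_pred F).
Proof.
split=> [|x y|x y]; rewrite -!topredE /= /integers_pred.
- exact/asboolP/integral1.
- by move=> /asboolP xi /asboolP yi; exact/asboolP/integral_sub.
- by move=> /asboolP xi /asboolP yi; exact/asboolP/integral_mul.
Qed.

HB.instance Definition _ (F : fieldExtType rat) :=
  GRing.isSubringClosed.Build F (integers_pred F)
    (integers_subring_closed F).

Definition integers (F : fieldExtType rat) : Type :=
  {x : F | x \in integers_pred F}.

HB.instance Definition _ (F : fieldExtType rat) :=
  SubChoice.on (integers F).
HB.instance Definition _ (F : fieldExtType rat) :=
  [SubChoice_isSubComNzRing of integers F by <:].

(* Nonzero prime ideals: the zero ideal has infinite norm, so it is never
   counted by [prime_pi], and it defines no place.
   Properness is part of [idealr_closed]. *)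
Definition prime_ideal (F : fieldExtType rat) (P : set (integers F)) : Prop :=
  [/\ idealr_closed [in P], prime_idealr_closed [in P] & P <> [set 0]].

(* N(P) = #(O_F / P), with the residue classes represented as sets.  The
   cardinal is 0 on infinite quotients, but O_F / P is finite for P nonzero. *)
Definition ideal_norm (F : fieldExtType rat) (P : set (integers F)) : nat :=
  #|` fset_set (range (fun x : integers F => [set y | P (y - x)])) |.

(* The number of primes with N(P) <= x; this set of primes is finite. *)
Definition prime_pi (R : realType) (F : fieldExtType rat) (x : R) : nat :=
  #|` fset_set [set P : set (integers F) |
        prime_ideal P /\ (ideal_norm P)%:R <= x] |.

Definition ideal_mul (A : comNzRingType) (I J : set A) : set A :=
  [set z | exists2 s : seq (A * A),
     (forall u, u \in s -> I u.1 /\ J u.2) & z = \sum_(u <- s) u.1 * u.2].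

Definition ideal_exp (A : comNzRingType) (I : set A) (n : nat) : set A :=
  iter n (ideal_mul I) setT.

(* The integers [i - j] such that [x = a / b] with a, b in O_F exactly
   divisible by P^i and P^j; for P prime and x nonzero there is exactly one. *)
Definition ord_set (F : fieldExtType rat) (P : set (integers F)) (x : F) :
    set int :=
  [set n | exists a b : integers F, exists i j : nat,
     [/\ \val b != 0, x = \val a / \val b,
         (ideal_exp P i `\` ideal_exp P i.+1) a,
         (ideal_exp P j `\` ideal_exp P j.+1) b & n = i%:Z - j%:Z]].

Definition ord (F : fieldExtType rat) (P : set (integers F)) (x : F) : int :=
  xget 0 (ord_set P x).

Definition finite_abs (R : realType) (F : fieldExtType rat)
    (P : set (integers F)) (x : F) : R :=
  if x == 0 then 0 else (ideal_norm P)%:R ^ (- ord P x).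

(* Each place is represented by its normalized absolute value (the one of the
   product formula): |s x| for a real embedding s, |s x|^2 for a complex one,
   N(P)^(- ord_P x) for a prime P.  Conjugate complex embeddings give the same
   function, hence are counted once. *)
Definition places (R : realType) (F : fieldExtType rat) : set (F -> R) :=
  [set v | exists s : {rmorphism F -> R[i]},
     (forall x, complex.Im (s x) = 0) /\
     v = (fun x => ComplexField.Normc.normc (s x))] `|`
  [set v | exists s : {rmorphism F -> R[i]},
     ~ (forall x, complex.Im (s x) = 0) /\
     v = (fun x => ComplexField.Normc.normc (s x) ^+ 2)] `|`
  [set v | exists P : set (integers F), prime_ideal P /\ v = finite_abs R P].
Arguments places : clear implicits.

(* [ln 0 = 0] in the library, so that log^+ 0 = 0 as it should be. *)
Definition logp (R : realType) (t : R) : R := Num.max (ln t) 0.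

Definition rat_adjoin (L : fieldExtType rat) (a : L) : {subfield L} :=
  <<1; a>>%AS.

(* [a] as an element of the field Q(a). *)
Definition adjoined (L : fieldExtType rat) (a : L) : subvs_of (rat_adjoin a) :=
  vsproj (rat_adjoin a) a.

(* m(a), the sum of log^+ |a|_v over the places v of Q(a).  Only finitely many
   terms are nonzero, as the finitely supported sum [\sum_(v \in _)] needs. *)
Definition mahler (R : realType) (L : fieldExtType rat) (a : L) : R :=
  \sum_(v \in places R (subvs_of (rat_adjoin a))) logp (v (adjoined a)).

(* Main.v *)
Require Import Defs.
From HB Require Import structures.
From mathcomp Require Import all_boot all_order all_algebra all_field.
From mathcomp Require Import ring_quotient finmap complex separable.
From mathcomp Require Import all_classical all_reals all_analysis.
From mathcomp Require Import ring lra zify.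
Import Order.TTheory GRing.Theory Num.Theory numFieldNormedType.Exports.
Import ComplexField.Normc.
Local Open Scope classical_set_scope.
Local Open Scope ring_scope.
Set Implicit Arguments.
Unset Strict Implicit.
Unset Printing Implicit Defensive.

(* Let K = Q(a) have degree d and let k be a subfield with [K : k] <= N.  Put
   M = X^N, D = M!, and b_j(x) = x^M (1 + t + ... + t^(D-1)) with t = x^(D^(j+1)).
   If p is a prime of k of norm at most X, then every element of a ring of at
   most M elements is killed by x^M (x^D - 1), and D = 0 in O_k/p; hence each
   b_j(a) vanishes modulo p.  With r such primes this gives |N(b_j(a))| >= 2^r,
   for every j.  On the other hand the product of b_0, ..., b_(n-1) telescopes to
   x^(Mn) (x^(D^(n+1)) - 1) / (x^D - 1), whose norm at a is at most
   2^d exp((Mn + D^(n+1)) m(a)), so that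
     r n log 2 <= d log 2 + (Mn + D^(n+1)) m(a)   as soon as d > D^(n+1).
   Dividing by n d and letting first i, then n, tend to infinity gives r/d -> 0.
   The bound 2^r <= |N(b)| comes from 2^r integers of k that are pairwise
   incongruent modulo b. *)

Local Notation pZQ := (map_poly (intr : int -> rat)).

(** * Quotients by prime ideals *)

(** An [idomainType] carries an inverse function. It is chosen classically on the elements that have
    an inverse and is the identity elsewhere; the carrier does not change. *)
Lemma idomain_of_integral (Q : comNzRingType) :
  (forall x y : Q, x * y = 0 -> (x == 0) || (y == 0)) ->
  exists (Q' : idomainType) (f : {rmorphism Q -> Q'}), bijective f.
Proof.
move=> Qint.
pose unit : {pred Q} := fun x => `[< exists y, y * x = 1 >].
pose inv : Q -> Q := fun x => if x \in unit then xget 0 [set y | y * x = 1] else x.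
have mulVx : {in unit, left_inverse 1 inv *%R}.
  move=> x ux; rewrite /inv ux.
  by have /asboolP [y yx] := ux; case: xgetP => // /(_ y); case.
have unitPl x y : y * x = 1 -> unit x by move=> yx; apply/asboolP; exists y.
have invr_out : {in [predC unit], inv =1 id}.
  by move=> x; rewrite inE /inv => /negbTE ->.
pose U := GRing.ComNzRing_hasMulInverse.Build Q mulVx unitPl invr_out.
pose Q1 : comUnitRingType := HB.pack (GRing.ComNzRing.sort Q) U.
pose I := GRing.ComUnitRing_isIntegral.Build Q1 Qint.
pose Q2 : idomainType := HB.pack (GRing.ComUnitRing.sort Q1) I.
exists Q2, (idfun : {rmorphism Q -> Q2}).
by exists id.
Qed.

Lemma quotient_prime (A : comNzRingType) (P : set A) :
  idealr_closed [in P] -> prime_idealr_closed [in P] ->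
  exists (Q : idomainType) (phi : {rmorphism A -> Q}),
    (forall y, exists x, phi x = y) /\ (forall x, phi x = 0 <-> P x).
Proof.
move=> Pid Ppr.
pose I0 : idealr A := HB.pack ([in P] : A -> bool)
  (isIdealr.Build A [in P] Pid).
pose I : prime_idealr A := HB.pack ([in P] : A -> bool) I0
  (isPrimeIdealrClosed.Build A [in P] Ppr).
pose Q0 := Quotient.quot (I : idealr A).
have [Q [f fbij]] := @idomain_of_integral Q0 (@Quotient.rquot_IdomainAxiom A I).
pose q : {rmorphism A -> Q0} := \pi_Q0%qT.
exists Q, (f \o q); split=> [y|x] /=.
- have [g fK gK] := fbij; exists (repr (g y)).
  by rewrite /q /= reprK gK.
- have fi := bij_inj fbij.
  have qE : (q x == 0) = (x \in P).
    by rewrite -(rmorph0 q) /q -[RHS]/(x \in I) -{2}[x]subr0 Quotient.idealrBE.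
  have f0 : f 0 = 0 := rmorph0 f; rewrite -f0; split=> [/fi/eqP|Px].
    by rewrite qE => /set_mem.
  by congr (f _); apply/eqP; rewrite qE; apply/mem_set.
Qed.

(** * Minimal polynomials, embeddings and integrality *)

Lemma map_poly_intr (K K' : nzRingType) (f : {rmorphism K -> K'}) (p : {poly int}) :
  map_poly f (map_poly intr p) = map_poly intr p.
Proof. by rewrite -map_poly_comp; apply: eq_map_poly => c; exact: rmorph_int. Qed.

(** Gauss's lemma: the primitive integral multiple [z] of the rational minimal polynomial divides a
    monic integral polynomial over the integers. Its leading coefficient is thus a unit, positive by
    normalization, so [z] is monic and is the minimal polynomial itself. *)
Lemma int_minpoly (F : fieldExtType rat) (x : F) : algebraic_integer x ->
  exists p : {poly int}, [/\ p \is monic, size p = (\dim <<1; x>>).+1,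
    minPoly 1%AS x = map_poly intr p & forall q : {poly rat},
    root (map_poly (in_alg F) q) x = (pZQ p %| q)].
Proof.
case=> p1 p1m p1x.
have /polyOver1P [q0 q0E] := minPolyOver 1%AS x.
have q0m : q0 \is monic.
  by have := monic_minPoly 1%AS x; rewrite q0E map_monic.
have q0D q : root (map_poly (in_alg F) q) x = (q0 %| q).
  apply/idP/idP=> [qx|/dvdpP [r ->]]; last first.
    by rewrite rmorphM rootM /= -q0E root_minPoly orbT.
  by rewrite -(dvdp_map (in_alg F)) -q0E minPoly_dvdp ?alg_polyOver.
have q0s : size q0 = (\dim <<1; x>>).+1.
  rewrite -(size_map_poly (in_alg F)) -q0E size_minPoly adjoin_degreeE.
  by rewrite dimv1 divn1.
have p1D : q0 %| pZQ p1.
  by rewrite -q0D map_poly_intr.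
have [q' [a a0 q'E]] := rat_poly_scale q0.
have q0nz : q0 != 0 by apply: monic_neq0.
have aQ0 : (a%:~R : rat)^-1 != 0 by rewrite invr_eq0 intr_eq0.
have q'D : q' %| p1.
  by rewrite -dvdp_rat_int; rewrite q'E dvdpZl in p1D.
have [r p1E] := dvdpP_int q'D.
pose z := zprimitive q'.
have q'nz : q' != 0.
  by apply: contraNneq q0nz => q'0; rewrite q'E q'0 rmorph0 scaler0.
have zm : z \is monic.
  have := sgz_lead_primitive q'; rewrite q'nz -/z => sz.
  have : lead_coef z * lead_coef r = 1.
    by rewrite -lead_coefM -p1E; exact/eqP/p1m.
  move=> /(congr1 absz); rewrite abszM => /eqP; rewrite muln_eq1 => /andP [/eqP zl _].
  rewrite monicE; move: sz zl; case: (lead_coef z) => // n _ /= ->.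
  by [].
have zE : pZQ z = q0.
  have q0E' : q0 = ((zcontents q')%:~R / a%:~R) *: pZQ z.
    rewrite q'E [in LHS](zpolyEprim q') map_polyZ /= scalerA mulrC //.
  have /eqP := q0m; rewrite {1}q0E' lead_coefZ.
  rewrite (monicP (monic_map intr zm)) mulr1 => e.
  by rewrite q0E' e scale1r.
exists z; split=> //; first by rewrite -q0s -zE size_rat_int_poly.
  by rewrite q0E -zE map_poly_intr.
by move=> q; rewrite q0D zE.
Qed.

(** The map q(a) |-> q(theta) is well defined: rational polynomials that agree at a differ by a
    multiple of p, which vanishes at theta. *)
Lemma embedding_exists (F : fieldExtType rat) (C : numFieldType) (a : F)
    (p : {poly int}) (theta : C) :
  (forall x : F, exists q : {poly rat}, x = (map_poly (in_alg F) q).[a]) ->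
  (forall q : {poly rat}, root (map_poly (in_alg F) q) a = (pZQ p %| q)) ->
  root (map_poly intr p) theta ->
  exists s : {rmorphism F -> C}, s a = theta.
Proof.
move=> gen minp rtheta.
have [rep repP] := choice gen.
have sE (q q' : {poly rat}) :
    (map_poly (in_alg F) q).[a] = (map_poly (in_alg F) q').[a] ->
    (map_poly (@ratr C) q).[theta] = (map_poly (@ratr C) q').[theta].
  move=> e; apply/eqP; rewrite -subr_eq0 -hornerN -hornerD -rmorphB /=.
  have : root (map_poly (in_alg F) (q - q')) a.
    by rewrite /root rmorphB /= hornerD hornerN e subrr.
  rewrite minp => /dvdpP [r ->].
  rewrite rmorphM /= hornerM map_poly_intr.
  by rewrite (eqP rtheta) mulr0.
pose s x := (map_poly (@ratr C) (rep x)).[theta].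
have sP q : s (map_poly (in_alg F) q).[a] = (map_poly (@ratr C) q).[theta].
  by apply: sE; rewrite -repP.
have sB : zmod_morphism s.
  move=> x y; rewrite /s [in RHS]/= -hornerN -hornerD -rmorphB /=.
  by apply: sE; rewrite -repP rmorphB hornerD hornerN -!repP.
have sM : monoid_morphism s.
  split=> [|x y].
    have {1}-> : 1 = (map_poly (in_alg F) 1).[a] by rewrite rmorph1 hornerC.
    by rewrite sP rmorph1 hornerC.
  rewrite /s -hornerM -rmorphM /=.
  by apply: sE; rewrite -repP rmorphM hornerM -!repP.
pose A := GRing.isZmodMorphism.Build F C s sB.
pose M := GRing.isMonoidMorphism.Build F C s sM.
pose S : {rmorphism F -> C} := HB.pack s A M.
exists S; rewrite /S /=.
have {1}-> : a = (map_poly (in_alg F) 'X).[a] by rewrite map_polyX hornerX.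
by rewrite sP map_polyX hornerX.
Qed.

Lemma integralOver_fmorph (F : fieldType) (K : nzRingType)
    (f : {rmorphism F -> K}) (x : F) :
  integralOver (intr : int -> K) (f x) -> integralOver (intr : int -> F) x.
Proof.
case=> p pm px; exists p => //.
by rewrite -(fmorph_root f) map_poly_intr.
Qed.

Lemma integralOver_rmorph (F K : nzRingType)
    (f : {rmorphism F -> K}) (x : F) :
  integralOver (intr : int -> F) x -> integralOver (intr : int -> K) (f x).
Proof.
case=> p pm px; exists p => //.
by rewrite -(map_poly_intr f); exact: rmorph_root.
Qed.

Lemma integral_coef_prod_XsubC (K : comNzRingType) (rs : seq K) :
  (forall r, r \in rs -> integralOver (intr : int -> K) r) ->
  forall i, integralOver (intr : int -> K) (\prod_(r <- rs) ('X - r%:P))`_i.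
Proof.
elim: rs => [_ i|r rs IH rsint i].
  by rewrite big_nil coef1; exact: (integral_nat intr).
have {}IH : forall i, integralOver (intr : int -> K) (\prod_(r <- rs) ('X - r%:P))`_i.
  by apply: IH => x xrs; apply: rsint; rewrite inE xrs orbT.
rewrite big_cons mulrC mulrBr coefB coefMX coefMC.
apply: integral_sub; last by apply: integral_mul => //; apply: rsint; rewrite mem_head.
by case: ifP => _; [exact: (integral_nat intr 0)|exact: IH].
Qed.

(* The minimal polynomial over k divides an integral polynomial, hence splits
   in C with integral roots. *)
Lemma integral_minimal_poly (k K : fieldExtType rat) (C : numClosedFieldType)
    (iota : {rmorphism k -> K}) (s : {rmorphism K -> C}) (a : K)
    (f : {poly k}) :
  algebraic_integer a -> f \is monic ->
  (forall g : {poly k}, root (map_poly iota g) a -> f %| g) ->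
  forall i, algebraic_integer f`_i.
Proof.
case=> p pm pa fm fmin i.
apply: (@integralOver_fmorph _ _ (s \o iota)).
rewrite -coef_map.
have [rs fE] := closed_field_poly_normal (map_poly (s \o iota) f).
rewrite fE (monicP (monic_map _ fm)) scale1r.
apply: integral_coef_prod_XsubC => r rrs; exists p => //.
have : f %| map_poly intr p.
  by apply: fmin; rewrite map_poly_intr.
rewrite -(dvdp_map (s \o iota)) fE (monicP (monic_map _ fm)) scale1r.
rewrite map_poly_intr.
by move=> /dvdpP [h ->]; rewrite rootM root_prod_XsubC rrs orbT.
Qed.

(** * Finiteness of residue rings *)

Lemma finite_roots (Q : idomainType) (p : {poly Q}) :
  p != 0 -> finite_set [set x | root p x].
Proof.
move=> p0; apply: contrapT => /(@infinite_set_fset _ _ (size p)) [B Bp Bs].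
have : (size (B : seq Q) < size p)%N.
  apply: max_poly_roots => //; [by apply/allP => x xB; apply: Bp|exact: fset_uniq].
by move=> /(leq_ltn_trans Bs); rewrite ltnn.
Qed.

Lemma root_integers (k : fieldExtType rat) (y : integers k) (p : {poly int}) :
  root (map_poly intr p) (\val y) = root (map_poly intr p) y.
Proof.
pose v : {rmorphism integers k -> k} := \val.
rewrite -(map_poly_intr v) /root horner_map -[in LHS](rmorph0 v).
by apply: inj_eq; exact: val_inj.
Qed.

(** A nonzero element of P yields a positive integer m that vanishes in [Q]. Each element of [Q] is
    then a root of one of finitely many nonzero polynomials: the image of an integral minimal
    polynomial, of degree at most [k : Q], with coefficients reduced modulo m. *)
Lemma finite_residue_ring (k : fieldExtType rat) (P : set (integers k))
    (Q : idomainType) (phi : {rmorphism integers k -> Q}) :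
  P <> [set 0] -> (forall y, exists x, phi x = y) ->
  (forall x, phi x = 0 <-> P x) -> finite_set [set: Q].
Proof.
move=> P0 surj ker.
have [a Pa a0] : exists2 a, P a & a != 0.
  apply: contrapT => H; apply: P0; apply/seteqP; split=> x /=.
    by move=> Px; apply/eqP; apply/negPn/negP => x0; apply: H; exists x.
  by move=> ->; apply/ker; rewrite rmorph0.
have [m m0 mQ] : exists2 m : nat, (0 < m)%N & (m%:R : Q) = 0.
  have /asboolP [p pm pa] := valP a.
  (* Removing the powers of x from p leaves q with q(a) = 0 and q(0) nonzero. Since a becomes 0 in
     [Q], so does q(0). *)
  have [n [q q0 pE]] := multiplicity_XsubC p 0.
  have {}q0 : ~~ root q 0 by move: q0; rewrite monic_neq0.
  have qa : root (map_poly intr q) a.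
    rewrite -root_integers; move: pa; rewrite pE rmorphM rmorphXn /= rootM subr0 map_polyX.
    case/orP => //; rewrite /root hornerXn expf_eq0 => /andP [_ /eqP va].
    by case/eqP: a0; apply: val_inj.
  exists `|q.[0]|%N; first by rewrite absz_gt0.
  have q0Q : (q.[0])%:~R = 0 :> Q.
    have := congr1 phi (eqP qa); rewrite rmorph0 -horner_map /= map_poly_intr.
    have -> : phi a = (0 : int)%:~R by apply/ker.
    by rewrite horner_map.
  by move: q0Q; case: (q.[0]) => n' //=; rewrite NegzE rmorphN => /eqP; rewrite oppr_eq0 => /eqP.
case: m m0 mQ => // m _ mQ.
pose d := \dim {:k}.
pose pt (t : {ffun 'I_d.+1 -> 'I_m.+1}) : {poly Q} :=
  \poly_(i < d.+1) (t (inord i) : nat)%:R.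
apply: (@sub_finite_set _ _ (\bigcup_(t in [set t | pt t != 0]) [set x | root (pt t) x])).
  move=> x _; have [y yx] := surj x.
  have /asboolP /int_minpoly [p [pm ps _ pmin]] := valP y.
  have py : root (map_poly intr p) x.
    rewrite -yx -(map_poly_intr phi) rmorph_root // -root_integers.
    by rewrite -(map_poly_intr (in_alg k)) pmin dvdpp.
  pose r (c : int) := `|(c %% m.+1)%Z|%N.
  have rm c : (r c < m.+1)%N.
    rewrite -ltz_nat /r gez0_abs ?modz_ge0 //; exact: ltz_pmod.
  have rQ c : (r c)%:R = c%:~R :> Q.
    rewrite [in RHS](divz_eq c m.+1) rmorphD rmorphM /= -[X in _ * X]/(m.+1%:R).
    by rewrite mQ mulr0 add0r -[in RHS](@gez0_abs (c %% m.+1)%Z) ?modz_ge0.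
  pose t := [ffun i : 'I_d.+1 => Ordinal (rm p`_i)].
  have ptE : pt t = map_poly intr p.
    apply/polyP => i; rewrite coef_poly coef_map.
    case: ltnP => [id|di]; first by rewrite ffunE /= inordK // rQ.
    rewrite nth_default // ps; apply: leq_trans di.
    by rewrite ltnS dimvS // subvf.
  exists t; last by rewrite /= ptE.
  by rewrite /= ptE; apply: monic_neq0; exact: monic_map.
apply: bigcup_finite; first exact: finite_finset.
by move=> t /= pt0; exact: finite_roots.
Qed.

(** Finiteness makes [ideal_norm] a true count of cosets, so the position of a coset in their
    enumeration is below X. The injection [c] serves as the cardinality bound in pigeonhole
    arguments. *)
Lemma residue_ring (k : fieldExtType rat) (P : set (integers k)) (X : nat) :
  prime_ideal P -> (ideal_norm P <= X)%N ->
  exists (Q : idomainType) (phi : {rmorphism integers k -> Q}) (c : Q -> 'I_X),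
    (forall x, phi x = 0 <-> P x) /\ injective c.
Proof.
move=> [Pid Ppr P0] NX.
have [Q [phi [surj ker]]] := quotient_prime Pid Ppr.
have Qfin := finite_residue_ring P0 surj ker.
pose fib (z : Q) := [set y | phi y = z].
have cosetE x : [set y | P (y - x)] = fib (phi x).
  apply/seteqP; split=> y /=.
    by move=> /ker; rewrite rmorphB => /eqP; rewrite subr_eq0 => /eqP.
  by move=> e; apply/ker; rewrite rmorphB e subrr.
pose T := range (fun x : integers k => [set y | P (y - x)]).
have Tfin : finite_set T.
  apply: (@sub_finite_set _ _ (fib @` [set: Q])); last exact: finite_image.
  by move=> _ [x _ <-]; exists (phi x) => //; rewrite cosetE.
have fibT z : fib z \in fset_set T.
  rewrite in_fset_set //; apply/mem_set; have [x <-] := surj z.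
  by exists x.
have cX z : (index (fib z) (fset_set T) < X)%N.
  by apply: leq_trans NX; rewrite /ideal_norm -/T index_mem.
exists Q, phi, (fun z => Ordinal (cX z)); split=> // z z' /(congr1 val) /=.
move=> zz'; have e : fib z = fib z'.
  by rewrite -(nth_index set0 (fibT z)) zz' nth_index //; exact: fibT.
have [x xz] := surj z.
have : fib z' x by rewrite -e.
by rewrite /fib /= xz.
Qed.

(** * The polynomials b_j and their vanishing modulo primes of small norm *)

(** This is b_j, available over every ring because it is used over the integers, over K, over O_k/P
    and over the complex numbers. *)
Definition spread (R : nzRingType) (M j : nat) : {poly R} :=
  'X^M * \sum_(l < M`!) 'X^(M`! ^ j.+1 * l).

Lemma map_spread (R R' : nzRingType) (f : {rmorphism R -> R'}) M j :
  map_poly f (spread R M j) = spread R' M j.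
Proof.
rewrite /spread rmorphM rmorphXn rmorph_sum /= map_polyX; congr (_ * _).
by apply: eq_bigr => l _; rewrite rmorphXn /= map_polyX.
Qed.

Lemma ord_pigeonhole (T : finType) (n : nat) (g : 'I_n -> T) :
  (#|T| < n)%N -> exists i j : 'I_n, (i < j)%N /\ g i = g j.
Proof.
move=> Tn; have : ~~ injectiveb g.
  by apply: contraL Tn => /injectiveP /leq_card; rewrite card_ord -leqNgt.
case/injectivePn => i [j ij gij].
case: (ltngtP i j) => [lt|lt|e]; first by exists i, j.
- by exists j, i.
- by case/eqP: ij; apply: val_inj.
Qed.

(** The ring Q[x]/(f) has at most M elements, so two powers of x coincide in it, with a gap that
    divides D. Each of the D summands of b_j therefore becomes x^M, and D vanishes in [Q]. *)
Lemma dvdp_spread (Q : idomainType) (X N : nat) (c : Q -> 'I_X) (f : {poly Q})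
    (j : nat) :
  injective c -> f \is monic -> (1 < size f <= N.+1)%N ->
  f %| spread Q (X ^ N) j.
Proof.
move=> cinj fm /andP [f1 fN]; set M := (X ^ N)%N; set D := M`!.
have X0 : (0 < X)%N by case: (X) (c 0) => [[]|].
have N0 : (0 < N)%N by rewrite -ltnS (leq_trans f1).
have XM : (X <= M)%N by rewrite /M -{1}(expn1 X) leq_pexp2l.
(* Two of the X + 1 multiples 0, 1, ..., X of the unit coincide; their gap is positive and at most X
   <= M, so it divides D = M!. *)
have D0 : (D%:R : Q) = 0.
  have [|i [l [il /cinj e]]] := @ord_pigeonhole 'I_X X.+1 (fun i => c (i : nat)%:R).
    by rewrite card_ord.
  have /dvdnP [q ->] : (l - i %| D)%N.
    apply: dvdn_fact; rewrite subn_gt0 il /= (leq_trans _ XM) //.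
    by apply: (leq_trans (leq_subr _ _)); rewrite -ltnS.
  by rewrite natrM natrB ?(ltnW il) // e subrr mulr0.
have f0 : f != 0 by apply: monic_neq0.
pose r i : {poly Q} := Pdiv.Ring.rmodp 'X^i f.
(* Remainders modulo f have at most N coefficients, hence at most X^N = M codes for the M + 1 powers
   1, x, ..., x^M. *)
have [|i [l [il e]]] :=
    @ord_pigeonhole {ffun 'I_N -> 'I_X} M.+1 (fun i => [ffun t : 'I_N => c (r i)`_t]).
  by rewrite card_ffun !card_ord.
have re : r i = r l.
  apply/polyP => t; case: (ltnP t N) => [tN|Nt].
    by move/ffunP: e => /(_ (Ordinal tN)); rewrite !ffunE => /cinj.
  have small n : (r n)`_t = 0.
    apply: nth_default; rewrite (leq_trans _ Nt) // -ltnS (leq_trans _ fN) //.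
    exact: Pdiv.Ring.ltn_rmodpN0.
  by rewrite !small.
have fd : f %| 'X^i * ('X^(l - i) - 1).
  rewrite mulrBr mulr1 -exprD subnKC ?(ltnW il) //.
  suff -> : 'X^l - 'X^i = (Pdiv.Ring.rdivp 'X^l f - Pdiv.Ring.rdivp 'X^i f) * f.
    exact: dvdp_mulIr.
  rewrite [in LHS](Pdiv.RingMonic.rdivp_eq fm 'X^l) [in LHS](Pdiv.RingMonic.rdivp_eq fm 'X^i).
  by rewrite -/(r _) -/(r _) re opprD addrACA subrr addr0 mulrBl.
have iM : (i <= M)%N by rewrite ltnW // (leq_trans il) // -ltnS.
have fD e' : f %| 'X^M * ('X^(D * e') - 1).
  rewrite -(subnK iM) exprD -mulrA dvdp_mull //.
  have /dvdnP [q ->] : (l - i %| D)%N.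
    apply: dvdn_fact; rewrite subn_gt0 il /=.
    by apply: (leq_trans (leq_subr _ _)); rewrite -ltnS.
  by rewrite mulnAC mulnC exprM subrX1 mulrA dvdp_mulr.
rewrite /spread -/D mulr_sumr.
rewrite (eq_bigr (fun t : 'I_D => 'X^M * ('X^(D * (D ^ j * t)) - 1) + 'X^M)); last first.
  by move=> t _; rewrite mulnA -expnS mulrBr mulr1 subrK.
rewrite big_split /= sumr_const card_ord.
rewrite dvdp_add //; last by rewrite -scaler_nat D0 scale0r dvdp0.
by apply: (big_ind (fun q => f %| q)) => [||t _]; [exact: dvdp0|exact: dvdp_add|exact: fD].
Qed.

(* If y^s + ... = 0 is integral, multiplying by b(a)^s turns e = b(a) y into
   e^s = b(a) h(a) with h over the integers of k; modulo P both sides are taken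
   in (O_k/P)[x]/(f), where b vanishes. *)
Lemma mem_prime_spread (k K : fieldExtType rat) (iota : {rmorphism k -> K})
    (a y : K) (e : integers k) (f : {poly k}) (P : set (integers k))
    (X N j : nat) :
  prime_ideal P -> (ideal_norm P <= X)%N ->
  f \is monic -> root (map_poly iota f) a -> (size f <= N.+1)%N ->
  (forall g : {poly k}, root (map_poly iota g) a -> f %| g) ->
  (forall i, algebraic_integer f`_i) ->
  algebraic_integer y ->
  iota (\val e) = (spread K (X ^ N) j).[a] * y -> P e.
Proof.
move=> Pp PX fm fa fN fmin fint [g gm gy] eE.
have [Q [phi [c [ker cinj]]]] := residue_ring Pp PX.
have [v vE vinj] : exists2 v : {rmorphism integers k -> k}, v =1 \val & injective v.
  by exists \val => //; exact: val_inj.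
have mem i : f`_i \in integers_pred k by apply/asboolP.
pose fO : {poly integers k} := \poly_(i < size f) (Sub f`_i (mem i)).
have fOE : map_poly v fO = f.
  apply/polyP=> i; rewrite coef_map coef_poly; case: ltnP => [_|le].
    exact: vE.
  by rewrite raddf0 nth_default.
have fOs : size fO = size f by rewrite -fOE size_map_inj_poly ?rmorph0.
have fOm : fO \is monic.
  rewrite monicE; apply/eqP/vinj; rewrite rmorph1 -(monicP fm) -fOE.
  by rewrite lead_coef_map_inj ?rmorph0.
have f1 : (1 < size f)%N.
  rewrite ltn_neqAle eq_sym size_poly_gt0 monic_neq0 // andbT.
  apply/eqP => s1; have fC := size1_polyC (eq_leq s1).
  have lc : f`_0 = 1 by rewrite -(monicP fm) lead_coefE s1.
  have f0 : f = 1 by rewrite fC lc.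
  by move: fa; rewrite f0 rmorph1 (negbTE (root1 _)).
have ffm : map_poly phi fO \is monic by exact: monic_map.
have ffs : size (map_poly phi fO) = size f.
  by rewrite size_map_poly_id0 ?fOs // (monicP fOm) rmorph1 oner_eq0.
set M := (X ^ N)%N in eE.
have fb : map_poly phi fO %| spread Q M j.
  by apply: (dvdp_spread _ cinj) => //; rewrite ffs f1.
set s := (size g).-1.
have gs : size g = s.+1 by rewrite /s prednK // size_poly_gt0 monic_neq0.
(* [H] homogenizes g with b_j as second variable: if x = b_j(a) y, its value at a is b_j(a)^s g(y) =
   0. *)
pose H (A : comNzRingType) (x : A) : {poly A} :=
  \sum_(i < s.+1) (g`_i)%:~R * x%:P ^+ i * spread A M j ^+ (s - i).
have mapH (A B : comNzRingType) (h : {rmorphism A -> B}) x :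
    map_poly h (H A x) = H B (h x).
  rewrite /H rmorph_sum /=; apply: eq_bigr => i _.
  by rewrite !rmorphM !rmorphXn /= rmorph_int map_polyC map_spread.
rewrite -vE in eE.
have gKs : size (map_poly (intr : int -> K) g) = s.+1.
  by rewrite size_map_poly_id0 // (monicP gm) oner_eq0.
have HK : (H K (iota (v e))).[a] = 0.
  transitivity ((spread K M j).[a] ^+ s * (map_poly intr g).[y]); last first.
    by rewrite (eqP gy) mulr0.
  rewrite (horner_coef (map_poly intr g)) gKs mulr_sumr /H horner_sum.
  apply: eq_bigr => i _; have is' : (i <= s)%N by rewrite -ltnS.
  have -> : (g`_i)%:~R = ((g`_i)%:~R)%:P :> {poly K} by rewrite rmorph_int.
  rewrite -rmorphXn; move: (spread K M j) eE => B eE.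
  rewrite !hornerM !hornerC horner_exp eE.
  have -> : B.[a] ^+ s = B.[a] ^+ (s - i) * B.[a] ^+ i.
    by rewrite -exprD subnK.
  rewrite exprMn coef_map /=; ring.
have fH : f %| H k (v e) by apply: fmin; rewrite mapH /root HK.
(* Divisibility by f descends from k to O_k: division by the monic [fO] is possible over O_k, and
   its remainder, divisible by f over k, is too short to be nonzero. *)
have [q HO] : exists q, H _ e = q * fO.
  exists (Pdiv.Ring.rdivp (H _ e) fO).
  have HE := Pdiv.RingMonic.rdivp_eq fOm (H _ e).
  set r := Pdiv.Ring.rmodp _ _ in HE.
  suff r0 : r = 0 by rewrite [LHS]HE r0 addr0.
  have rs : (size r < size fO)%N by rewrite Pdiv.Ring.ltn_rmodpN0 ?monic_neq0.
  apply: (map_inj_poly vinj (rmorph0 v)); rewrite rmorph0.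
  have : f %| map_poly v r.
    move: fH; rewrite -(mapH _ _ v) HE rmorphD rmorphM /= fOE.
    by rewrite dvdp_addr // dvdp_mull.
  apply: contraTeq => rn0; apply: contraL rs => /dvdp_leq - /(_ rn0).
  by rewrite size_map_inj_poly ?rmorph0 // fOs -leqNgt.
have : map_poly phi fO %| (phi e)%:P ^+ s.
  have : map_poly phi fO %| H Q (phi e) by rewrite -mapH HO rmorphM dvdp_mull.
  rewrite /H big_ord_recr /= subnn expr0 mulr1.
  have -> : g`_s = 1 by rewrite -(monicP gm) lead_coefE.
  rewrite mul1r dvdp_addr //.
  apply: (big_ind (fun q => map_poly phi fO %| q)) => [||i _].
  - exact: dvdp0.
  - by move=> ? ?; exact: dvdp_add.
  - rewrite dvdp_mull // -(subnSK (ltn_ord i)) exprS dvdp_mulr //.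
(* A nonconstant monic polynomial cannot divide a nonzero constant, and [Q] is a domain. *)
move=> fe; apply/ker/eqP; rewrite -[_ == 0]andTb.
apply: contraLR fe; rewrite /= => pe0; apply/negP => /dvdp_leq.
rewrite expf_neq0 ?polyC_eq0 // => /(_ isT).
by rewrite ffs -rmorphXn /= size_polyC expf_neq0 // leqNgt f1.
Qed.

(** * Counting residues by determinants *)

(** In Smith normal form A = L diag(d_i) R with L and R unimodular, a class modulo the row lattice
    of A is determined by the coordinates of v R^-1 modulo the d_i, and the product of the |d_i| is
    |det A|. *)
Lemma lattice_index (n : nat) (A : 'M[int]_n) (W : finType) (v : W -> 'rV[int]_n) :
  \det A != 0 -> (forall w w' u, v w - v w' = u *m A -> w = w') ->
  (#|W| <= `|\det A|)%N.
Proof.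
move=> A0 vinj.
have [L Lu [R Ru [d _ AE]]] := int_Smith_normal_form A.
have DE : \matrix_(i, j) (d`_i *+ (i == j :> nat)) = diag_mx (\row_i d`_i) :> 'M[int]_n.
  by apply/matrixP => i j; rewrite !mxE val_eqE; case: eqP => [->|].
pose dd i : int := d`_i.
have unit1 (M : 'M[int]_n) : M \in unitmx -> `|\det M|%N = 1%N.
  rewrite unitmxE => /mulrV /(congr1 absz); rewrite abszM => /eqP.
  by rewrite muln_eq1 => /andP [/eqP].
have detE : `|\det A|%N = \prod_(i < n) `|dd i|%N.
  rewrite AE DE !det_mulmx !abszM (unit1 L) // (unit1 R) // mul1n muln1 det_diag.
  rewrite (big_morph absz abszM (erefl _)) //.
  by apply: eq_bigr => i _; rewrite mxE.
have d0 (i : 'I_n) : d`_i != 0.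
  apply: contraNneq A0 => di; rewrite -absz_eq0 detE (bigD1 i) //= muln_eq0 absz_eq0.
  by rewrite /dd di eqxx.
have dmod (x : int) (i : 'I_n) : (`|(x %% d`_i)%Z| < `|dd i|)%N.
  by rewrite -ltz_nat gez0_abs ?modz_ge0 // ltz_mod.
pose h w : {dffun forall i : 'I_n, 'I_(`|dd i|%N)} :=
  [ffun i => Ordinal (dmod ((v w *m invmx R) 0 i) i)].
suff hinj : injective h.
  rewrite detE (leq_trans (leq_card h hinj)) // card_dep_ffun foldrE big_map.
  rewrite big_enum /=; apply/eq_leq; apply: eq_bigr => i _; exact: card_ord.
move=> w w' /ffunP hw.
pose x := (v w - v w') *m invmx R.
have xd i : (dd i %| x 0%R i)%Z.
  rewrite /x mulmxBl !mxE -eqz_mod_dvd; apply/eqP.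
  have := congr1 val (hw i); rewrite !ffunE /= => /(congr1 Posz).
  by rewrite !gez0_abs ?modz_ge0 // !mxE.
have xR : v w - v w' = x *m R by rewrite /x mulmxKV.
clearbody x; pose x' := \row_i (x 0%R i %/ dd i)%Z.
have xE : x = x' *m diag_mx (\row_i d`_i).
  by rewrite mul_mx_diag; apply/rowP => i; rewrite !mxE divzK.
apply: (vinj w w' (x' *m invmx L)).
by rewrite xR [in RHS]AE DE !mulmxA mulmxKV // -xE.
Qed.

Section ResidueCount.
Variables (C : numFieldType) (p : {poly int}) (rs : seq C).
Hypotheses (pm : p \is monic) (rs_uniq : uniq rs).
Hypothesis p_split : map_poly intr p = \prod_(r <- rs) ('X - r%:P).

Let n := size rs.

Let size_p : size p = n.+1.
Proof.
rewrite -(@size_map_poly_id0 _ C intr) ?(monicP pm) ?oner_eq0 //.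
by rewrite p_split size_prod_XsubC.
Qed.

(** Multiplication by g on Z[x]/(p) in the basis of powers of x, acting on row vectors. *)
Definition mul_mod (g : {poly int}) : 'M[int]_n :=
  \matrix_(i < n) poly_rV (Pdiv.Ring.rmodp (g * 'X^i) p).

Let small q : (size (Pdiv.Ring.rmodp q p) <= n)%N.
Proof. by rewrite -ltnS -size_p Pdiv.Ring.ltn_rmodpN0 ?monic_neq0. Qed.

Let horner_rmodp q r : r \in rs ->
  (map_poly intr (Pdiv.Ring.rmodp q p)).[r] = (map_poly intr q).[r] :> C.
Proof.
move=> rrs; rewrite [in RHS](Pdiv.RingMonic.rdivp_eq pm q) rmorphD rmorphM /=.
rewrite hornerD hornerM p_split.
have /eqP -> : root (\prod_(r <- rs) ('X - r%:P)) r by rewrite root_prod_XsubC.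
by rewrite mulr0 add0r.
Qed.

(** The Vandermonde matrix of the roots of p diagonalizes multiplication by g, with eigenvalues
    g(r); it is invertible since the roots are distinct. *)
Lemma det_mul_mod g :
  (\det (mul_mod g))%:~R = \prod_(r <- rs) (map_poly intr g).[r] :> C.
Proof.
pose a : 'rV[C]_n := \row_i rs`_i.
pose V : 'M[C]_n := Vandermonde n a.
have V0 : \det V != 0.
  rewrite det_Vandermonde; apply/prodf_neq0 => i _; apply/prodf_neq0 => j ij.
  by rewrite !mxE subr_eq0 nth_uniq // gtn_eqF.
pose dg : 'rV[C]_n := \row_i (map_poly intr g).[rs`_i].
have BV : map_mx intr (mul_mod g) *m V = V *m diag_mx dg.
  rewrite mul_mx_diag; apply/matrixP => i j; rewrite !mxE.
  have jrs : rs`_j \in rs by exact: mem_nth.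
  transitivity (map_poly intr (g * 'X^i)).[rs`_j]; last first.
    by rewrite rmorphM /= map_polyXn hornerM hornerXn mulrC.
  rewrite -horner_rmodp // (horner_coef_wide _ (n := n)); last first.
    by rewrite (leq_trans (size_poly _ _)) // small.
  by apply: eq_bigr => t _; rewrite !mxE coef_map.
have := congr1 determinant BV.
rewrite !det_mulmx det_map_mx det_diag mulrC => /(mulfI V0) ->.
by rewrite (big_nth 0) big_mkord; apply: eq_bigr => i _; rewrite mxE.
Qed.

(* Z[x]/(p, g) has at most |Res(p, g)| elements. *)
Lemma residue_count (g : {poly int}) (W : finType) (h : W -> {poly int}) :
  (forall r, r \in rs -> (map_poly intr g).[r] != 0) ->
  (forall w w' u q, h w - h w' = g * u + p * q -> w = w') ->
  #|W|%:R <= `|\prod_(r <- rs) (map_poly intr g).[r]| :> C.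
Proof.
move=> g0 hinj; rewrite -det_mul_mod.
have B0 : \det (mul_mod g) != 0.
  rewrite -(intr_eq0 C) det_mul_mod prodf_seq_neq0.
  by apply/allP => r; exact: g0.
rewrite -intr_norm -[#|W|%:R]/((#|W|%:Z)%:~R) ler_int -abszE lez_nat.
(* The row lattice of [mul_mod g] is the ideal generated by g in Z[x]/(p), so congruence modulo it
   is congruence modulo (p, g). *)
apply: (lattice_index (v := fun w => poly_rV (Pdiv.Ring.rmodp (h w) p))) => // w w' u.
move=> /(congr1 rVpoly); rewrite linearB /= !poly_rV_K // mulmx_sum_row linear_sum /=.
rewrite (eq_bigr (fun i : 'I_n => Pdiv.Ring.rmodp (u 0 i *: (g * 'X^i)) p)); last first.
  by move=> i _; rewrite linearZ /= rowK poly_rV_K // Pdiv.RingMonic.rmodpZ.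
rewrite -Pdiv.RingMonic.rmodp_sum // -Pdiv.RingMonic.rmodpB // => e.
have e2 := Pdiv.RingMonic.rdivp_eq pm (h w - h w').
have e3 := Pdiv.RingMonic.rdivp_eq pm (\sum_(i < n) u 0 i *: (g * 'X^i)).
apply: (hinj w w' (\sum_(i < n) u 0 i *: 'X^i)
  (Pdiv.Ring.rdivp (h w - h w') p - Pdiv.Ring.rdivp (\sum_(i < n) u 0 i *: (g * 'X^i)) p)).
rewrite mulr_sumr; under eq_bigr => i _ do rewrite -scalerAr.
by rewrite [in LHS]e2 e [X in _ = X + _]e3; ring.
Qed.
End ResidueCount.

(** * Integers of k separated by finitely many primes *)

(** If x lies in Q but not in P, two powers of x agree in the finite domain O_k/P, so some x^m - 1
    with m > 0 lies in P, hence in Q; then 1 lies in Q. *)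
Lemma prime_ideal_maximal (k : fieldExtType rat) (P Q : set (integers k)) :
  prime_ideal P -> prime_ideal Q -> P `<=` Q -> P = Q.
Proof.
move=> Pp Qp PQ; apply/seteqP; split=> // x Qx; apply: contrapT => Px.
have [A [phi [c [ker cinj]]]] := residue_ring Pp (leqnn _).
have [B [psi [_ [kerQ _]]]] := residue_ring Qp (leqnn _).
have [|i [j [ij /cinj e]]] :=
    @ord_pigeonhole 'I_(ideal_norm P) (ideal_norm P).+1 (fun i => c (phi x ^+ i)).
  by rewrite card_ord.
have : phi (x ^+ (j - i) - 1) = 0.
  rewrite rmorphB rmorph1 rmorphXn /=.
  apply: (@mulfI _ (phi x ^+ i)); first by rewrite expf_neq0 //; apply/eqP => /ker.
  by rewrite mulrBr mulr1 mulr0 -exprD subnKC ?(ltnW ij) // e subrr.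
move=> /ker /PQ /kerQ; rewrite rmorphB rmorphXn rmorph1.
have -> : psi x = 0 by apply/kerQ.
by rewrite expr0n subn_eq0 leqNgt ij sub0r => /eqP; rewrite oppr_eq0 oner_eq0.
Qed.

(** By maximality, for i != j some element lies in P_j and not in P_i. The product over j of these
    elements stays outside P_i because P_i is prime. *)
Lemma separating_elements (k : fieldExtType rat) (r : nat)
    (P : 'I_r -> set (integers k)) :
  injective P -> (forall i, prime_ideal (P i)) ->
  exists c : 'I_r -> integers k,
    (forall i j, i != j -> P j (c i)) /\ (forall i, ~ P i (c i)).
Proof.
move=> Pinj Pp.
have /choice [c cP] : forall ij : 'I_r * 'I_r, exists x : integers k,
    ij.1 != ij.2 -> P ij.2 x /\ ~ P ij.1 x.
  move=> [i j] /=; case: (eqVneq i j) => [_|ij]; first by exists 0.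
  apply: contrapT => H; case/eqP: ij; apply: Pinj.
  symmetry; apply: prime_ideal_maximal => // x Pjx.
  by apply: contrapT => Pix; apply: H; exists x.
exists (fun i => \prod_(j | i != j) c (i, j)); split=> [i j ij|i].
  have [B [psi [_ [ker _]]]] := residue_ring (Pp j) (leqnn _).
  apply/ker; rewrite rmorph_prod (bigD1 j) //=.
  have -> : psi (c (i, j)) = 0 by apply/ker; have [] := cP (i, j) ij.
  by rewrite mul0r.
have [B [psi [_ [ker _]]]] := residue_ring (Pp i) (leqnn _).
move=> /ker/eqP; rewrite rmorph_prod; apply/negP/prodf_neq0 => j ij.
by apply/eqP => /ker; have [] := cP (i, j) ij.
Qed.

(** Modulo P_i only the summand c_i survives, so e_S is nonzero modulo P_i exactly when i is in
    S. *)
Lemma subset_sums (k : fieldExtType rat) (r : nat)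
    (P : 'I_r -> set (integers k)) :
  injective P -> (forall i, prime_ideal (P i)) ->
  exists e : {set 'I_r} -> integers k,
    forall S T, (forall i, P i (e S - e T)) -> S = T.
Proof.
move=> Pinj Pp; have [c [cP cNP]] := separating_elements Pinj Pp.
exists (fun S : {set 'I_r} => \sum_(i in S) c i) => S T ST; apply/setP => i.
have [B [psi [_ [ker _]]]] := residue_ring (Pp i) (leqnn _).
have sumE (U : {set 'I_r}) :
    psi (\sum_(j in U) c j) = if i \in U then psi (c i) else 0.
  rewrite rmorph_sum /=; case: ifP => iU.
    rewrite (bigD1 i) //= big1 ?addr0 // => j /andP [_ ji].
    by apply/ker; apply: cP.
  rewrite big1 // => j jU; apply/ker; apply: cP.
  by apply: contraTneq jU => ->; rewrite iU.
have /ker := ST i; rewrite rmorphB !sumE.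
have ci : psi (c i) <> 0 by move=> /ker; exact: cNP.
by case: (i \in S); case: (i \in T) => //; rewrite ?subr0 ?sub0r // => /eqP;
  rewrite oppr_eq0 => /eqP.
Qed.

(** * Lower bound for the norm of b_j(a) *)

(** Residues are counted in Z[x]/(p), that is in Z[a], which need not contain all integers of K; a
    common denominator moves finitely many elements there. *)
Lemma common_denominator (K : fieldExtType rat) (a : K) (T : finType) (x : T -> K) :
  (forall x : K, exists q : {poly rat}, x = (map_poly (in_alg K) q).[a]) ->
  exists (m : nat) (h : T -> {poly int}), (0 < m)%N /\
    forall t, m%:R * x t = (map_poly intr (h t)).[a].
Proof.
move=> gen.
have /choice [h hP] : forall t, exists h : {poly int} * nat,
    (0 < h.2)%N /\ h.2%:R * x t = (map_poly intr h.1).[a].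
  move=> t; have [q xE] := gen (x t).
  have [q' [m m0 qE]] := rat_poly_scale q.
  exists (sgz m *: q', `|m|%N) => /=; split; first by rewrite absz_gt0.
  have -> : (`|m|%N)%:R = (sgz m)%:~R * m%:~R :> K.
    by rewrite -intrM -[(`|m|%N)%:R]/((`|m|%N : int)%:~R) abszEsg.
  rewrite xE qE map_polyZ [in RHS]map_polyZ /= !hornerZ map_poly_intr -!mulrA.
  congr (_ * _); rewrite mulrA -[m%:~R](rmorph_int (in_alg K)) -rmorphM /=.
  by rewrite divff ?intr_eq0 // scale1r mul1r.
exists (\prod_t (h t).2)%N, (fun t => (\prod_(t' | t' != t) (h t').2)%:R *: (h t).1).
split=> [|t]; first by apply: prodn_gt0 => t; have [] := hP t.
rewrite (bigD1 t) //= natrM mulrAC (proj2 (hP t)) mulrC.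
by rewrite map_polyZ hornerZ /= rmorph_nat.
Qed.

(** Bernoulli's inequality (1 + 1/n)^t >= 1 + t/n, cleared of denominators in [bern], shows that (n
    + 1)^t exceeds m n^t already for t = n m + 1. *)
Lemma leq_of_leq_expn (Q n m : nat) :
  (forall t, Q ^ t <= m * n ^ t)%N -> (Q <= n)%N.
Proof.
move=> H; rewrite leqNgt; apply/negP => nQ.
have n0 : (0 < n)%N.
  case: (n) H => // /(_ 1%N); rewrite exp0n // muln0 leqn0 expn1.
  by case: (Q) nQ.
have bern t : (n ^ t * (n + t) <= n * n.+1 ^ t)%N.
  elim: t => [|t IH]; first by rewrite !expn0 addn0; lia.
  have : (n ^ t * (n + t) * n.+1 <= n * n.+1 ^ t * n.+1)%N by rewrite leq_mul2r IH orbT.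
  rewrite !expnS; move: (n ^ t)%N (n.+1 ^ t)%N => u v; nia.
have := H (n * m).+1; set t := (n * m).+1 => Ht.
have : (n ^ t * (n + t) <= n ^ t * (n * m))%N.
  apply: leq_trans (bern t) _; rewrite mulnCA leq_mul2l gtn_eqF //=.
  by rewrite mulnC (leq_trans _ Ht) // leq_exp2r.
by rewrite leq_mul2l expn_eq0 gtn_eqF //= /t; lia.
Qed.

(* The digits e_S, S a set of primes, are pairwise incongruent modulo b(a), so
   the words of length t in base b(a) are pairwise incongruent modulo b(a)^t.
   They lie in m^-1 Z[a], hence 2^(rt) <= m^d |N b(a)|^t; let t grow. *)
Lemma spread_norm_ge (C : numFieldType) (k K : fieldExtType rat)
    (iota : {rmorphism k -> K}) (a : K) (p : {poly int}) (rs : seq C)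
    (f : {poly k}) (X N j r : nat) (P : 'I_r -> set (integers k)) :
  (forall x : K, exists q : {poly rat}, x = (map_poly (in_alg K) q).[a]) ->
  p \is monic ->
  (forall q : {poly rat}, root (map_poly (in_alg K) q) a = (pZQ p %| q)) ->
  uniq rs -> map_poly intr p = \prod_(x <- rs) ('X - x%:P) ->
  f \is monic -> root (map_poly iota f) a -> (size f <= N.+1)%N ->
  (forall g : {poly k}, root (map_poly iota g) a -> f %| g) ->
  (forall i, algebraic_integer f`_i) ->
  injective P -> (forall i, prime_ideal (P i)) ->
  (forall i, ideal_norm (P i) <= X)%N ->
  (forall x, x \in rs -> (spread C (X ^ N) j).[x] != 0) ->
  (2 ^ r)%:R <= `|\prod_(x <- rs) (spread C (X ^ N) j).[x]|.
Proof.
move=> gen pm minp rsu psplit fm fa fN fmin fint Pinj Pp PX nz.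
pose b : {poly int} := spread int (X ^ N) j.
have bC : map_poly intr b = spread C (X ^ N) j by exact: map_spread.
have bK : map_poly intr b = spread K (X ^ N) j by exact: map_spread.
clearbody b.
have pa : root (map_poly intr p) a.
  by rewrite -(map_poly_intr (in_alg K)) minp dvdpp.
have aint : algebraic_integer a by exists p.
have hint (q : {poly int}) : algebraic_integer (map_poly intr q).[a].
  apply: integral_horner => //; apply/integral_poly => i.
  by rewrite coef_map; exact: (integral_id intr).
(* If b(a) = 0, then p divides b, and b vanishes at a root of p in [C], contrary to [nz]. *)
have b0 : (map_poly intr b).[a] != 0 :> K.
  apply/negP; rewrite -(map_poly_intr (in_alg K)) -/(root _ _) minp.
  rewrite -(dvdp_map (@ratr C : {rmorphism rat -> C})) !map_poly_intr psplit bC => D.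
  have : (1 < size p)%N.
    rewrite ltn_neqAle eq_sym size_poly_gt0 monic_neq0 // andbT.
    apply/eqP => s1; have lc : p`_0 = 1 by rewrite -(monicP pm) lead_coefE s1.
    have p1 : p = 1 by rewrite (size1_polyC (eq_leq s1)) lc.
    by move: pa; rewrite p1 rmorph1 (negbTE (root1 _)).
  rewrite -(@size_map_poly_id0 _ C intr) ?(monicP pm) ?oner_eq0 //.
  rewrite psplit size_prod_XsubC ltnS; case: (rs) nz D => // x s nz /dvdpP [q qE] _.
  have := nz x (mem_head _ _); rewrite qE hornerM big_cons hornerM.
  by rewrite hornerXsubC subrr mul0r mulr0 eqxx.
have [e eP] := subset_sums Pinj Pp.
have [m [h [m0 hP]]] := common_denominator (fun S => iota (\val (e S))) gen.
have {}hP S : m%:R * iota (\val (e S)) = (map_poly intr (h S)).[a] by exact: hP.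
(* [z] evaluates a word with digits e_S in base b(a) by Horner's rule; [H] is the integer polynomial
   whose value at a is m z. *)
pose z := foldr (fun S y => iota (\val (e S)) + (map_poly intr b).[a] * y) (0 : K).
pose H := foldr (fun S q => h S + b * q) (0 : {poly int}).
have HE w : (map_poly intr (H w)).[a] = m%:R * z w.
  elim: w => [|S w IH] /=; first by rewrite rmorph0 horner0 mulr0.
  by rewrite rmorphD rmorphM /= hornerD hornerM IH -hP; ring.
have zint w : algebraic_integer (z w).
  elim: w => [|S w IH] /=; first exact: (integral_nat intr 0).
  apply: integral_add; last by apply: integral_mul => //; exact: hint.
  by apply: integralOver_rmorph; have /asboolP := valP (e S).
have zinj t (w w' : seq {set 'I_r}) (u : {poly int}) : size w = t -> size w' = t ->
    z w - z w' = (map_poly intr b).[a] ^+ t * (map_poly intr u).[a] -> w = w'.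
  elim: t w w' => [[] // [] //|t IH [//|S w] [//|T w'] [sw] [sw'] /= E].
  (* The first digits differ by b(a) times an algebraic integer, so their difference lies in every
     P_i. Once they are equal, cancelling b(a) leaves words of length t. *)
  have ST : S = T.
    apply: eP => i.
    apply: (@mem_prime_spread k K iota a ((map_poly intr b).[a] ^+ t
      * (map_poly intr u).[a] - (z w - z w')) _ f _ X N j) => //.
      apply: integral_sub; last by apply: integral_sub; exact: zint.
      apply: integral_mul; last exact: hint.
      by rewrite -horner_exp -rmorphXn; exact: hint.
    have -> : \val (e S - e T) = \val (e S) - \val (e T) by [].
    rewrite -bK rmorphB mulrBr mulrA -exprS -E; ring.
  rewrite ST; congr (_ :: _); apply: IH => //.
  apply: (mulfI b0); rewrite mulrA -exprS -E ST; ring.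
have detE := @det_mul_mod C p rs pm rsu psplit b.
pose n := `|\det (mul_mod p rs b)|%N.
have BE : `|\prod_(x <- rs) (spread C (X ^ N) j).[x]| = n%:R.
  by rewrite -bC -detE -intr_norm -abszE.
rewrite BE ler_nat; apply: (@leq_of_leq_expn _ _ (m ^ size rs)) => t.
rewrite -(ler_nat C) natrM [X in _ <= X * _]natrX [X in _ <= _ * X]natrX -BE.
pose W := (t.-tuple {set 'I_r} : finType).
have cW : #|W| = ((2 ^ r) ^ t)%N.
  by rewrite card_tuple -cardsT -powersetT card_powerset cardsT card_ord.
have gE : \prod_(x <- rs) (map_poly intr (m%:R * b ^+ t)).[x]
    = m%:R ^+ size rs * (\prod_(x <- rs) (spread C (X ^ N) j).[x]) ^+ t :> C.
  rewrite -prodrXl (eq_bigr (fun x => m%:R * (spread C (X ^ N) j).[x] ^+ t)); last first.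
    by move=> x _; rewrite rmorphM rmorph_nat rmorphXn /= -bC hornerM horner_exp
      -[m%:R]polyC_natr hornerC.
  by rewrite big_split /= big_const_seq count_predT iter_mulr_1.
(* The modulus is m b^t because [H] carries the denominator m. Its norm has the extra factor m^d,
   independent of t, which [leq_of_leq_expn] removes. *)
have := @residue_count C p rs pm rsu psplit (m%:R * b ^+ t) W H.
rewrite gE normrM !normrX normr_nat cW; apply=> [x xrs|w w' u q E].
  rewrite rmorphM rmorph_nat rmorphXn /= bC hornerM horner_exp -polyC_natr hornerC.
  by rewrite mulf_neq0 ?expf_neq0 ?nz // pnatr_eq0 -lt0n.
apply: val_inj; apply: (zinj t _ _ u); rewrite ?size_tuple //.
have mK : (m%:R : K) != 0 by rewrite -(rmorph_nat (in_alg K)) fmorph_eq0 pnatr_eq0 -lt0n.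
apply: (mulfI mK); rewrite mulrBr -!HE -hornerN -hornerD -rmorphB /= E.
rewrite rmorphD !rmorphM rmorph_nat rmorphXn /= hornerD !hornerM horner_exp.
by rewrite (eqP pa) mul0r addr0 -[(m%:R : {poly K})]polyC_natr hornerC mulrA.
Qed.

(** * The Mahler measure as a sum over conjugates *)

Lemma logp_ge0 (R : realType) (t : R) : 0 <= logp t.
Proof. by rewrite /logp le_max lexx orbT. Qed.

Lemma logp_le1 (R : realType) (t : R) : t <= 1 -> logp t = 0.
Proof. by move=> t1; apply/max_idPr; exact: ln_le0. Qed.

Lemma logp_sqr (R : realType) (t : R) : 0 <= t -> logp (t ^+ 2) = logp t *+ 2.
Proof.
rewrite le_eqVlt => /orP [/eqP <-|t0]; first by rewrite expr0n /= logp_le1 ?mul0rn.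
rewrite /logp lnXn //; case: (leP 0 (ln t)) => h.
  by rewrite !max_l // mulrn_wge0.
by rewrite !max_r ?mul0rn // ?mulrn_wle0 // ltW.
Qed.

Lemma ideal_exp_mulr (A : comNzRingType) (P : set A) (n : nat) (c x : A) :
  idealr_closed [in P] -> ideal_exp P n x -> ideal_exp P n (c * x).
Proof.
move=> [P0 _ Plin]; case: n => [//|n] [s sP ->].
exists [seq (c * u.1, u.2) | u <- s].
  move=> _ /mapP [u us ->] /=; have [Pu ?] := sP u us; split=> //.
  apply/set_mem; rewrite -[c * _]addr0; apply: Plin => //; exact: mem_set.
by rewrite big_map mulr_sumr; apply: eq_bigr => u _; rewrite mulrA.
Qed.

Lemma ideal_exp_decr (A : comNzRingType) (P : set A) (m n : nat) :
  (m <= n)%N -> ideal_exp P n `<=` ideal_exp P m.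
Proof.
have step i : ideal_exp P i.+1 `<=` ideal_exp P i.
  elim: i => [//|i IH] x [s sP ->]; exists s => // u us.
  by have [? ?] := sP u us; split=> //; exact: IH.
elim: n => [|n IH]; first by rewrite leqn0 => /eqP ->.
rewrite leq_eqVlt => /orP [/eqP -> //|]; rewrite ltnS => /IH mn x /step.
exact: mn.
Qed.

(** For x = c / d as in [ord_set], c = x d lies in P^j along with d, so j <= i and the order is
    nonnegative. *)
Lemma finite_abs_le1 (R : realType) (F : fieldExtType rat) (P : set (integers F))
    (x : F) :
  prime_ideal P -> algebraic_integer x -> finite_abs R P x <= 1.
Proof.
move=> [Pid _ _] xint; rewrite /finite_abs; case: ifP => // _.
suff [n ->] : exists n : nat, ord P x = n.
  rewrite -exprnN; case: n => [|n]; first by rewrite expr0 invr1.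
  have [->|N0] := eqVneq (ideal_norm P) 0%N; first by rewrite expr0n invr0.
  rewrite invf_le1; last by rewrite exprn_gt0 // ltr0n lt0n.
  by rewrite exprn_ege1 // ler1n lt0n.
(* If [ord_set] is empty, [ord] takes the default value 0. *)
rewrite /ord; case: xgetP => [z _ [c [d [i [j [d0 xE [ci cNi] [dj _] ->]]]]]|_].
  2: by exists 0%N.
have xmem : x \in integers_pred F by apply/asboolP.
have cE : c = Sub x xmem * d :> integers F.
  by apply: val_inj; rewrite /= xE divfK.
exists (i - j)%N; rewrite subzn // leqNgt; apply/negP => ij.
apply: cNi; rewrite cE; apply: (ideal_exp_decr ij).
exact: ideal_exp_mulr.
Qed.

(* Archimedean places of F = Q(a) correspond to the conjugates of a in the
   closed upper half plane; the nonreal ones count twice. *)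
Lemma sum_logp_le_places (R : realType) (F : fieldExtType rat) (a : F)
    (p : {poly int}) (rs : seq R[i]) :
  algebraic_integer a ->
  (forall x : F, exists q : {poly rat}, x = (map_poly (in_alg F) q).[a]) ->
  (forall q : {poly rat}, root (map_poly (in_alg F) q) a = (pZQ p %| q)) ->
  uniq rs -> map_poly intr p = \prod_(x <- rs) ('X - x%:P) ->
  \sum_(x <- rs) logp (normc x) <= \sum_(v \in places R F) logp (v a).
Proof.
move=> aint gen minp rsu psplit.
have /choice [rep repP] := gen.
(* An embedding is determined by the image th of a; [ev th] expresses it through chosen polynomial
   representatives. *)
pose ev (th : R[i]) x : R[i] := (map_poly (ratr : rat -> R[i]) (rep x)).[th].
have evE (s : {rmorphism F -> R[i]}) x : s x = ev (s a) x.
  rewrite {1}(repP x) -horner_map /ev -map_poly_comp; congr (_.[_]).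
  by apply: eq_map_poly => c /=; rewrite alg_num_field fmorph_rat.
have pa : root (map_poly intr p) a by rewrite -(map_poly_intr (in_alg F)) minp dvdpp.
have rs_root th : (th \in rs) = root (map_poly intr p) th.
  by rewrite psplit root_prod_XsubC.
have s_rs (s : {rmorphism F -> R[i]}) : s a \in rs.
  by rewrite rs_root -(map_poly_intr s); exact: rmorph_root.
have emb th : th \in rs -> exists2 s : {rmorphism F -> R[i]}, s a = th & s =1 ev th.
  rewrite rs_root => /(embedding_exists gen minp) [s sa]; exists s => // x.
  by rewrite evE sa.
pose v1 th : F -> R := fun x => normc (ev th x).
pose v2 th : F -> R := fun x => normc (ev th x) ^+ 2.
pose V th : F -> R := if complex.Im th == 0 then v1 th else v2 th.
have Vplace th : th \in rs -> places R F (V th).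
  move=> /emb [s sa sE]; left; rewrite /V; case: eqP => [th0|th0].
    left; exists s; split=> [x|]; last by apply/funext => x; rewrite sE.
    rewrite sE /ev; have -> : th = (complex.Re th)%:C%C.
      by case: (th) th0 => x' y' /= ->.
    have -> : map_poly (ratr : rat -> R[i]) (rep x) =
        map_poly (real_complex R) (map_poly ratr (rep x)).
      rewrite -map_poly_comp; apply: eq_map_poly => c /=.
      exact/esym/(fmorph_rat (real_complex R)).
    by rewrite horner_map.
  right; exists s; split=> [H|]; last by apply/funext => x; rewrite sE.
  by apply: th0; rewrite -sa; exact: H.
pose T := [seq th <- rs | 0 <= complex.Im th].
have Trs th : th \in T -> th \in rs /\ 0 <= complex.Im th.
  by rewrite mem_filter => /andP [].
have sqr_normc (z : R[i]) : normc z ^+ 2 = complex.Re z ^+ 2 + complex.Im z ^+ 2.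
  by case: z => x y /=; rewrite sqr_sqrtr // addr_ge0 // sqr_ge0.
have Vinj : {in T &, injective V}.
  move=> th th' /Trs [/emb [s sa sE] im] /Trs [/emb [s' sa' sE'] im'] VV.
  (* The value at 2 is 2 for a real place and 4 for a complex one, which fixes the exponent. Then
     |th|^2 and |th + 1|^2 determine Re th and |Im th|, and Im th >= 0 on [T]. *)
  have two : normc 2%:R = 2%:R :> R.
    by rewrite -(rmorph_nat (real_complex R)) /= expr0n addr0 sqrtr_sqr normr_nat.
  have V2 : V th 2%:R = V th' 2%:R by rewrite VV.
  have sq x : normc (ev th x) ^+ 2 = normc (ev th' x) ^+ 2.
    have := congr1 (fun v => v x) VV.
    move: V2; rewrite /V; case: eqP => e; case: eqP => e' //; rewrite /v1 /v2.
    - by move=> _ ->.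
    - by rewrite -sE -sE' !rmorph_nat two; lra.
    - by rewrite -sE -sE' !rmorph_nat two; lra.
  have := sq a; have := sq (a + 1).
  rewrite -!sE -!sE' !rmorphD !rmorph1 sa sa' !sqr_normc.
  case: (th) im => x y; case: (th') im' => x' y' /= im' im e1 e2.
  have xx : x = x' by lra.
  congr (Complex _ _) => //; move: e2; rewrite xx => /addrI /eqP.
  by rewrite eqrXn2 // => /eqP.
pose B := [seq V th | th <- T].
have Bu : uniq B by rewrite map_inj_in_uniq // filter_uniq.
have Bsub : [set` B] `<=` places R F.
  by move=> v /= /mapP [th /Trs [thrs _] ->]; exact: Vplace.
(* Primes contribute nothing, a being integral, so only archimedean places remain. A sum with
   infinite support would default to 0. *)
have fin : finite_set (places R F `&` (fun v => logp (v a)) @^-1` [set~ 0]).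
  apply: (@sub_finite_set _ _ [set` [seq v1 th | th <- rs] ++ [seq v2 th | th <- rs]]);
    last exact: finite_seq.
  move=> v [[[]|] [s [sP vE]] /= v0]; rewrite /= mem_cat.
  - apply/orP; left; apply/mapP; exists (s a) => //.
    by rewrite vE; apply/funext => x; rewrite evE.
  - apply/orP; right; apply/mapP; exists (s a) => //.
    by rewrite vE; apply/funext => x; rewrite evE.
  - by case: v0; rewrite vE; apply/logp_le1/finite_abs_le1.
rewrite fsbig_supp (fsbigID [set` B]) //.
apply: (@le_trans _ _ (\sum_(v \in [set` B]) logp (v a))); last first.
  rewrite -[leLHS]addr0 lerD ?fsumr_ge0 // => [|v _]; last exact: logp_ge0.
  rewrite le_eqVlt; apply/orP; left; apply/eqP; symmetry.
  apply: fsbig_widen => [v [] //|v [Bv /not_andP [|//]]].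
  by move=> /= nv; apply: contrapT => v0; apply: nv; split=> //; exact: Bsub.
rewrite -fsbig_seq // big_map.
have VT th : th \in T ->
    logp (V th a) = logp (normc th) *+ (if complex.Im th == 0 then 1%N else 2%N).
  move=> /Trs [/emb [s sa sE] _]; rewrite /V /v1 /v2; case: eqP => _.
    by rewrite -sE sa.
  by rewrite -sE sa logp_sqr //; case: (th) => x y; exact: sqrtr_ge0.
rewrite (eq_big_seq _ VT).
have conj_rs th : (conjc th \in rs) = (th \in rs).
  by rewrite !rs_root -complex_root_conj map_poly_intr.
have conj_perm : perm_eq (map conjc rs) rs.
  apply: uniq_perm => //; first by rewrite map_inj_uniq //; exact: can_inj (@conjcK R).
  move=> th; apply/mapP/idP => [[z zrs ->]|thrs]; first by rewrite conj_rs.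
  by exists (conjc th); rewrite ?conj_rs ?conjcK.
rewrite le_eqVlt; apply/orP; left; apply/eqP.
(* Conjugation permutes the roots and moves those of the open lower half plane to the upper one,
   which doubles the nonreal terms. *)
rewrite (bigID (fun th => 0 <= complex.Im th)) /= -[X in _ + X](perm_big _ conj_perm).
rewrite big_map big_filter big_mkcond [X in _ + X]big_mkcond [RHS]big_mkcond -big_split /=.
apply: eq_bigr => -[x y] _ /=; rewrite oppr_ge0 sqrrN -ltNge.
by case: (ltgtP 0 y) => _; rewrite ?addr0 ?add0r ?mulr2n.
Qed.

(** * The telescoping product and its size *)

(** With t = x^(D^(j+1)), the geometric sum in b_j is (t^D - 1)/(t - 1), whose numerator is the
    denominator for j + 1. *)
Lemma spread_prod (R : comNzRingType) (M n : nat) :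
  (\prod_(j < n) spread R M j) * ('X^(M`!) - 1) =
  'X^(M * n) * ('X^(M`! ^ n.+1) - 1).
Proof.
elim: n => [|n IH]; first by rewrite big_ord0 muln0 expn1 expr0.
rewrite big_ord_recr /= mulrAC IH /spread.
have -> : 'X^(M`! ^ n.+2) - 1 = ('X^(M`! ^ n.+1) - 1) *
    \sum_(l < M`!) 'X^(M`! ^ n.+1 * l) :> {poly R}.
  rewrite expnSr exprM subrX1; congr (_ * _).
  by apply: eq_bigr => l _; rewrite exprM.
rewrite mulnS exprD; ring.
Qed.

Lemma normc_ge0 (R : rcfType) (z : R[i]) : 0 <= normc z.
Proof. by case: z => x y; exact: sqrtr_ge0. Qed.

Lemma normrE_normc (R : rcfType) (z : R[i]) : `|z| = (normc z)%:C%C.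
Proof. by case: z. Qed.

Lemma normc_le_expR_logp (R : realType) (t : R) : 0 <= t -> t <= expR (logp t).
Proof.
move=> t0; case: (leP t 1) => t1; last by rewrite /logp max_l ?lnK ?ln_ge0 ?posrE ?(lt_trans ltr01) // ltW.
by rewrite logp_le1 // expR0.
Qed.

(** Here [expR (logp (normc z))] is max(1, |z|), and its e-th power bounds both terms of z^e - 1. *)
Lemma normr_monomial_le (R : realType) (z : R[i]) (m e : nat) :
  `|z ^+ m * (z ^+ e - 1)| <= (2 * expR (logp (normc z)) ^+ (m + e))%:C%C.
Proof.
have z1 : `|z| <= (expR (logp (normc z)))%:C%C.
  by rewrite normrE_normc lecR normc_le_expR_logp ?normc_ge0.
have u1 : 1 <= expR (logp (normc z)) by rewrite -expR0 ler_expR logp_ge0.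
rewrite normrM normrX exprD mulrCA rmorphM /= rmorphXn /=.
apply: ler_pM => //; first by rewrite lerXn2r ?nnegrE // (le_trans _ z1).
apply: (le_trans (ler_normB _ _)); rewrite normrX normr1.
rewrite rmorphM rmorphXn /= (rmorph_nat (real_complex R)) mulr_natl mulr2n.
apply: lerD; first by rewrite lerXn2r ?nnegrE // (le_trans _ z1).
by rewrite exprn_ege1 // -(rmorph1 (real_complex R)) lecR.
Qed.

(** * Comparison of the two norm estimates *)

Lemma sub_embedding (L : fieldExtType rat) (k K : {subfield L}) : (k <= K)%VS ->
  exists iota : {rmorphism subvs_of k -> subvs_of K},
    forall x, vsval (iota x) = vsval x.
Proof.
move=> /subvP kK.
pose iota (x : subvs_of k) : subvs_of K := vsproj K (vsval x).
have iotaE x : vsval (iota x) = vsval x by rewrite vsprojK // kK // subvsP.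
have iB : zmod_morphism iota.
  move=> x y; apply: val_inj.
  by rewrite [LHS]iotaE -[RHS]/(vsval (iota x) - vsval (iota y)) !iotaE.
have iM : monoid_morphism iota.
  split=> [|x y]; first apply: val_inj.
    exact: (etrans (iotaE 1) (etrans
      (rmorph1 (vsval : {rmorphism subvs_of k -> L}))
      (esym (rmorph1 (vsval : {rmorphism subvs_of K -> L}))))).
  apply: val_inj.
  by rewrite [LHS]iotaE -[RHS]/(vsval (iota x) * vsval (iota y)) !iotaE.
pose A := GRing.isZmodMorphism.Build _ _ iota iB.
pose M := GRing.isMonoidMorphism.Build _ _ iota iM.
pose S : {rmorphism subvs_of k -> subvs_of K} := HB.pack iota A M.
by exists S.
Qed.

(** The n lower bounds 2^r, multiplied by |N(a^D - 1)| >= 1, bound the norm of the telescoped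
    product from below; the conjugates of a bound it from above. Logarithms give the inequality. *)
Lemma prime_count_bound (R : realType) (L : fieldExtType rat) (alpha : L)
    (k : {subfield L}) (N X n r : nat) (P : 'I_r -> set (integers (subvs_of k))) :
  algebraic_integer alpha -> (k <= rat_adjoin alpha)%VS ->
  (\dim_k (rat_adjoin alpha) <= N)%N ->
  injective P -> (forall i, prime_ideal (P i)) ->
  (forall i, ideal_norm (P i) <= X)%N ->
  ((X ^ N)`! ^ n.+1 < \dim (rat_adjoin alpha))%N ->
  (r * n)%:R * ln 2 <= (\dim (rat_adjoin alpha))%:R * ln 2 +
    ((X ^ N) * n + (X ^ N)`! ^ n.+1)%:R * mahler R alpha.
Proof.
set K := rat_adjoin alpha; set d := \dim K; set M := (X ^ N)%N; set D := M`!.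
move=> aint kK dkN Pinj Pp PX Ed.
pose a : subvs_of K := adjoined alpha.
have aE : vsval a = alpha by rewrite vsprojK // memv_adjoin.
pose v : {rmorphism subvs_of K -> L} := vsval.
have vinj : injective v by exact: val_inj.
have vA c : v (in_alg (subvs_of K) c) = in_alg L c.
  by rewrite !in_algE !alg_num_field fmorph_rat.
have vQ (q : {poly rat}) : root (map_poly (in_alg (subvs_of K)) q) a
    = root (map_poly (in_alg L) q) alpha.
  rewrite -aE -(fmorph_root v) -map_poly_comp; congr (root _ _).
  by apply: eq_map_poly => c; exact: vA.
have [p [pm ps mE pmin]] := int_minpoly aint.
have minp q : root (map_poly (in_alg (subvs_of K)) q) a = (pZQ p %| q).
  by rewrite vQ pmin.
have gen (x : subvs_of K) : exists q : {poly rat},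
    x = (map_poly (in_alg (subvs_of K)) q).[a].
  have /Fadjoin1_polyP [q xE] := subvsP x; exists q.
  apply: vinj; rewrite -horner_map -map_poly_comp [LHS]xE (aE : v a = alpha).
  by congr (_.[_]); apply: eq_map_poly => c; exact/esym/vA.
have [rs psplit] := closed_field_poly_normal (map_poly (intr : int -> R[i]) p).
rewrite (monicP (monic_map _ pm)) scale1r in psplit.
have rsu : uniq rs.
  rewrite -separable_prod_XsubC -psplit.
  rewrite -(map_poly_intr (ratr : {rmorphism rat -> R[i]})) separable_map.
  rewrite -(separable_map (in_alg L)) map_poly_intr -mE.
  by apply: pcharf0_separable => q; rewrite (fmorph_pchar (in_alg L)) pchar_num.
have rsd : size rs = d.
  apply: succn_inj; rewrite -(size_prod_XsubC rs id) -psplit.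
  by rewrite size_map_poly_id0 ?ps // (monicP pm) oner_eq0.
have emb x : x \in rs -> exists s : {rmorphism subvs_of K -> R[i]}, s a = x.
  move=> xrs; apply: (embedding_exists gen minp).
  by rewrite psplit root_prod_XsubC.
(* A nonzero polynomial of degree below d vanishes at no conjugate of a; this is where D^(n+1) < d
   enters. *)
have adeg (q : {poly int}) : q != 0 -> (size q <= d)%N ->
    forall x, x \in rs -> (map_poly intr q).[x] != 0.
  move=> q0 qd x /emb [s <-]; apply/negP.
  rewrite -(map_poly_intr s) horner_map fmorph_eq0 -(map_poly_intr (in_alg (subvs_of K))).
  rewrite -/(root _ _) minp => /dvdp_leq; rewrite !size_rat_int_poly ps => /(_ _).
  by rewrite -size_poly_eq0 size_rat_int_poly size_poly_eq0 => /(_ q0); rewrite ltnNge qd.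
have xn0 m : (0 < m)%N -> (m < d)%N -> forall x, x \in rs -> x ^+ m - 1 != 0.
  move=> m0 md x xrs; have := adeg ('X^m - 1) _ _ x xrs.
  rewrite rmorphB rmorph1 /= map_polyXn !hornerE; apply.
    by rewrite -size_poly_eq0 size_XnsubC.
  by rewrite size_XnsubC.
have x0 x : x \in rs -> x != 0.
  move=> xrs; have := adeg 'X _ _ x xrs; rewrite map_polyX hornerX; apply.
    by rewrite polyX_eq0.
  by rewrite size_polyX (leq_ltn_trans _ Ed) // expn_gt0 fact_gt0.
have prodx x := congr1 (fun q => q.[x]) (spread_prod R[i] M n).
have Dd : (D < d)%N.
  by apply: leq_ltn_trans Ed; rewrite -[in leqLHS](expn1 D) leq_pexp2l ?fact_gt0.
(* By the telescoping identity, a zero of b_j is a zero of x^(Mn) (x^(D^(n+1)) - 1). *)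
have spread0 (j : 'I_n) x : x \in rs -> (spread R[i] M j).[x] != 0.
  move=> xrs; apply/negP => /eqP s0; have := prodx x.
  rewrite /= !hornerM (bigD1 j) //= hornerM s0 !mul0r hornerXn => /esym/eqP.
  rewrite mulf_eq0 expf_eq0 (negbTE (x0 _ xrs)) andbF !hornerE.
  by apply/negP/xn0 => //; rewrite expn_gt0 fact_gt0.
have [iota iotaE] := sub_embedding kK.
have /polyOver_subvs [f fE] := minPolyOver k alpha.
pose vk : {rmorphism subvs_of k -> L} := vsval.
have viota (g : {poly subvs_of k}) : root (map_poly iota g) a = root (map_poly vk g) alpha.
  rewrite -aE -(fmorph_root v) -map_poly_comp; congr (root _ _).
  by apply: eq_map_poly => c; exact: iotaE.
have fm : f \is monic by rewrite -(map_monic vk) -fE monic_minPoly.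
have fa : root (map_poly iota f) a by rewrite viota -fE root_minPoly.
have fmin (g : {poly subvs_of k}) : root (map_poly iota g) a -> f %| g.
  rewrite viota => ga; rewrite -(dvdp_map vk) -fE minPoly_dvdp //.
  by apply/polyOver_subvs; exists g.
have fN : (size f <= N.+1)%N.
  rewrite -(size_map_poly vk) -fE size_minPoly adjoin_degreeE ltnS.
  apply: leq_trans dkN; rewrite leq_div2r // dimvS //.
  by apply/FadjoinP; rewrite kK memv_adjoin.
have aint' : algebraic_integer a by apply: (@integralOver_fmorph _ _ v); rewrite /v /= aE.
have fint : forall i, algebraic_integer f`_i.
  have [x xrs] : exists x, x \in rs.
    case: (rs) rsd => [|x s] sd; last by exists x; rewrite mem_head.
    by move: Ed; rewrite -sd.
  have [s _] := emb x xrs.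
  by move=> i; apply: (@integral_minimal_poly _ _ _ iota s a).
have bound j : (j < n)%N -> (2 ^ r)%:R <= `|\prod_(x <- rs) (spread R[i] M j).[x]|.
  move=> jn; apply: (spread_norm_ge gen pm minp rsu psplit fm fa fN fmin fint Pinj) => // x.
  exact: (spread0 (Ordinal jn)).
(* The norm of a^D - 1 is a nonzero integer; the residue count with a one-element family says so. *)
have one : 1 <= `|\prod_(x <- rs) ('X^D - 1 : {poly R[i]}).[x]|.
  have XD : map_poly (intr : int -> R[i]) ('X^D - 1) = 'X^D - 1.
    by rewrite rmorphB rmorph1 /= map_polyXn.
  have := @residue_count _ p rs pm rsu psplit ('X^D - 1) unit (fun _ => 0).
  rewrite card_unit XD; apply => [x xrs|[] [] //].
  by rewrite !hornerE xn0 // fact_gt0.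
have big : ((2 ^ r) ^ n)%:R <=
    `|\prod_(x <- rs) (x ^+ (M * n) * (x ^+ (D ^ n.+1) - 1))|.
  have -> : \prod_(x <- rs) (x ^+ (M * n) * (x ^+ (D ^ n.+1) - 1)) =
      (\prod_(j < n) \prod_(x <- rs) (spread R[i] M j).[x]) *
      \prod_(x <- rs) ('X^D - 1 : {poly R[i]}).[x].
    rewrite exchange_big -big_split; apply: eq_bigr => x _ /=.
    by have := prodx x; rewrite /= !hornerE horner_prod => <-.
  rewrite normrM normr_prod -[leLHS]mulr1 ler_pM // natrX.
  rewrite -[n in _ ^+ n]card_ord -prodr_const; apply: ler_prod => j _.
  by rewrite ler0n bound.
pose l (x : R[i]) := logp (normc x).
set e := (M * n + D ^ n.+1)%N.
have {}big : ((2 ^ r) ^ n)%:R <= 2 ^+ d * expR (e%:R * \sum_(x <- rs) l x).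
  rewrite -lecR (rmorph_nat (real_complex R)); apply: (le_trans big).
  rewrite normr_prod mulr_sumr expR_sum -rsd -(count_predT rs) -iter_mulr_1 -big_const_seq.
  rewrite -big_split rmorph_prod /=; apply: ler_prod => x _; rewrite normr_ge0 /=.
  by rewrite expRM_natl normr_monomial_le.
have mah : \sum_(x <- rs) l x <= mahler R alpha.
  exact: (sum_logp_le_places aint' gen minp rsu psplit).
have : ln ((2 ^ r) ^ n)%:R <= ln (2 ^+ d * expR (e%:R * \sum_(x <- rs) l x)).
  by rewrite ler_ln // posrE ?mulr_gt0 ?exprn_gt0 ?expR_gt0 ?ltr0n ?expn_gt0.
rewrite lnM ?posrE ?exprn_gt0 ?expR_gt0 // expRK lnXn // -expnM natrX lnXn //.
rewrite -[ln 2 *+ (r * n)]mulr_natl -[ln 2 *+ d]mulr_natl.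
by move=> /le_trans; apply; rewrite lerD2l ler_wpM2l.
Qed.

(** * From the norm estimates to the limit *)

Lemma prime_pi_bound (R : realType) (L : fieldExtType rat) (alpha : L)
    (k : {subfield L}) (N X n : nat) (x : R) :
  algebraic_integer alpha -> (k <= rat_adjoin alpha)%VS ->
  (\dim_k (rat_adjoin alpha) <= N)%N -> x <= X%:R ->
  ((X ^ N)`! ^ n.+1 < \dim (rat_adjoin alpha))%N ->
  (prime_pi (subvs_of k) x * n)%:R * ln 2 <=
    (\dim (rat_adjoin alpha))%:R * ln 2 +
    ((X ^ N) * n + (X ^ N)`! ^ n.+1)%:R * mahler R alpha.
Proof.
move=> aint kK dkN xX Ed; rewrite /prime_pi; set A := [set P | _].
set S := fset_set A.
(* [fset_set A] is empty when [A] is infinite, so the inclusion holds in both cases. *)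
have SA Q : Q \in S -> A Q.
  rewrite /S; have [Afin|Ainf] := pselect (finite_set A).
    by rewrite in_fset_set // => /set_mem.
  by rewrite /fset_set; case: pselect.
pose P (i : 'I_#|` S|) := nth set0 S i.
have PA i : A (P i) by apply: SA; exact: mem_nth.
apply: (@prime_count_bound _ _ _ k N X n _ P) => // [i j /eqP|i|i].
- by rewrite nth_uniq ?fset_uniq // => /eqP /val_inj.
- by have [] := PA i.
- by have [_ Nx] := PA i; rewrite -(ler_nat R) (le_trans Nx).
Qed.

(** Since d = [K : k] [k : Q] <= N [k : Q], dividing by [k : Q] instead of d costs the factor N. *)
Lemma prime_pi_ratio_bound (R : realType) (L : fieldExtType rat) (alpha : L)
    (k : {subfield L}) (N X n : nat) (x : R) :
  algebraic_integer alpha -> (k <= rat_adjoin alpha)%VS ->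
  (\dim_k (rat_adjoin alpha) <= N)%N -> x <= X%:R -> (0 < n)%N ->
  ((X ^ N)`! ^ n.+1 < \dim (rat_adjoin alpha))%N ->
  (prime_pi (subvs_of k) x)%:R / (\dim k)%:R <=
    N%:R * n%:R^-1 * (1 + ((X ^ N) * n + (X ^ N)`! ^ n.+1)%:R / ln 2 *
      (mahler R alpha / (\dim (rat_adjoin alpha))%:R)).
Proof.
move=> aint kK dkN xX n0 Ed.
have := prime_pi_bound aint kK dkN xX Ed.
have := dim_sup_field kK.
move: (prime_pi _ _) (mahler R alpha) (_ + _)%N => r m c.
move: Ed; move: (\dim (rat_adjoin alpha)) dkN => d dkN Ed dE.
have d0 : (0 < d)%N by apply: leq_ltn_trans Ed.
have dk0 : (0 < \dim k)%N by rewrite adim_gt0.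
have l0 : 0 < ln 2 :> R by rewrite ln_gt0 // ltr1n.
have dN : (d <= N * \dim k)%N by rewrite dE leq_mul2r dkN orbT.
move: (\dim k) dk0 dN => dk dk0 dN; rewrite natrM => bd.
have nR : 0 < n%:R :> R by rewrite ltr0n.
have dR : 0 < d%:R :> R by rewrite ltr0n.
have dkR : 0 < dk%:R :> R by rewrite ltr0n.
have rnn : r%:R <= n%:R^-1 * (d%:R + c%:R / ln 2 * m).
  rewrite mulrC ler_pdivlMr // -(ler_pM2r l0) (le_trans bd) // mulrDl.
  by rewrite [c%:R / ln 2 * m]mulrAC divfK ?gt_eqF.
have rn0 : 0 <= n%:R^-1 * (d%:R + c%:R / ln 2 * m) := le_trans (ler0n R r) rnn.
have e : n%:R^-1 * (d%:R + c%:R / ln 2 * m) =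
    d%:R * (n%:R^-1 * (1 + c%:R / ln 2 * (m / d%:R))).
  by rewrite mulrCA; congr (_ * _); rewrite mulrDr mulr1 [_ * (m / _)]mulrA mulrCA divff ?mulr1 // gt_eqF.
rewrite e in rnn rn0; rewrite ler_pdivrMr // (le_trans rnn) //.
rewrite pmulr_rge0 // in rn0.
rewrite -[N%:R * _ * _]mulrA [leRHS]mulrAC ler_wpM2r // -natrM ler_nat //.
Qed.

Theorem mainTheorem13 (R : realType) (L : nat -> fieldExtType rat)
    (alpha : forall i : nat, L i)
    (alpha_int : forall i, algebraic_integer (alpha i))
    (mahler_small :
      (fun i => mahler R (alpha i) / (\dim (rat_adjoin (alpha i)))%:R : R)
        @ \oo --> (0 : R))
    (degree_infty : (fun i => \dim (rat_adjoin (alpha i))) @ \oo --> \oo) :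
  (forall x : R, 0 < x ->
     (fun i => (prime_pi (subvs_of (rat_adjoin (alpha i))) x)%:R
                 / (\dim (rat_adjoin (alpha i)))%:R : R)
       @ \oo --> (0 : R)) /\
  (forall (N : nat) (k : forall i : nat, {subfield L i}),
     (1 <= N)%N ->
     (forall i, (k i <= rat_adjoin (alpha i))%VS /\
                (\dim_(k i) (rat_adjoin (alpha i)) <= N)%N) ->
     forall x : R, 0 < x ->
       (fun i => (prime_pi (subvs_of (k i)) x)%:R / (\dim (k i))%:R : R)
         @ \oo --> (0 : R)).
Proof.
have part2 : forall (N : nat) (k : forall i : nat, {subfield L i}),
     (1 <= N)%N ->
     (forall i, (k i <= rat_adjoin (alpha i))%VS /\
                (\dim_(k i) (rat_adjoin (alpha i)) <= N)%N) ->
     forall x : R, 0 < x ->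
       (fun i => (prime_pi (subvs_of (k i)) x)%:R / (\dim (k i))%:R : R)
         @ \oo --> (0 : R).
  move=> N k N1 kP x x0; apply/cvgrPdist_lt => e e0.
  have [X xX] : exists X : nat, x <= X%:R.
    by exists (Num.bound x); rewrite ltW // archi_boundP // ltW.
  (* The 2 bounds the factor 1 + c m(a)/d for large i, once n and hence c are fixed. *)
  have [n n0 ne] : exists2 n : nat, (0 < n)%N & N%:R * n%:R^-1 * 2 < e.
    exists (Num.bound (N%:R * 2 / e)).+1 => //.
    rewrite mulrAC ltr_pdivrMr ?ltr0n // [ltRHS]mulrC -ltr_pdivrMr //.
    have h : 0 <= N%:R * 2 / e by rewrite divr_ge0 ?mulr_ge0 // ltW.
    by rewrite (lt_trans (archi_boundP h)) // ltr_nat.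
  set c : R := ((X ^ N) * n + (X ^ N)`! ^ n.+1)%:R / ln 2.
  have c0 : 0 <= c by rewrite divr_ge0 // ln_ge0 // ler1n.
  (* From m(a)/d < 1/(c + 1) follows c m(a)/d <= 1. *)
  have c1 : 0 < (c + 1)^-1 by rewrite invr_gt0 ltr_wpDl.
  have /cvgrPdist_lt /(_ _ c1) m_near := mahler_small.
  have /cvgnyPgt /(_ ((X ^ N)`! ^ n.+1)%N) d_near := degree_infty.
  near=> i.
  have [kK dkN] := kP i.
  rewrite sub0r normrN ger0_norm ?divr_ge0 //.
  have bd : ((X ^ N)`! ^ n.+1 < \dim (rat_adjoin (alpha i)))%N by near: i.
  apply: (le_lt_trans (prime_pi_ratio_bound (alpha_int i) kK dkN xX n0 bd)).
  apply: le_lt_trans ne; rewrite ler_wpM2l // ?mulr_ge0 // -/c.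
  have : `|0 - mahler R (alpha i) / (\dim (rat_adjoin (alpha i)))%:R| < (c + 1)^-1.
    by near: i.
  rewrite sub0r normrN => /ltW h; have h' := le_trans (ler_norm _) h.
  have : c * (mahler R (alpha i) / (\dim (rat_adjoin (alpha i)))%:R) <= c * (c + 1)^-1.
    by rewrite ler_wpM2l.
  have : c * (c + 1)^-1 <= 1 by rewrite ler_pdivrMr ?mul1r ?ltr_wpDl // lerDl.
  move: (c * _) (c * _) => u w; lra.
(* Part (1) is part (2) for the full field, of relative degree 1. *)
split=> // x x0; apply: (part2 1%N (fun i => rat_adjoin (alpha i))) => // i; split=> //.
by rewrite divnn; case: (0 < _)%N.
Unshelve. all: by end_near.
Qed.
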